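(* Let $f_e:\mathbb{R}^d\to\mathbb{R}^m$ be a (measurable) encoder with $\|f_e(\bm u)\|_2=1$ for all $\bm u$, with smoothed version $\hat f_e(\bm u)=\mathbb{E}_{\bm\varepsilon\sim\mathcal N(0,I)}[f_e(\bm u+\bm\varepsilon)]$ and Gaussian robustness score $\hat S$. Let $\bm x,\bm x'\in\mathbb{R}^d$ and $\epsilon\ge0$ with $\|\bm x'-\bm x\|_2\le\epsilon$. Let $\bm z=f_e(\bm x)$ be the normalized clean prediction, let $\hat{\bm z}'=\hat f_e(\bm x')/\|\hat f_e(\bm x')\|_2$ be the normalized adversarial prediction, let $\bm t_y\in\mathbb{R}^m$ be a unit vector (target prediction), and let $a_y=\bm z^\top\bm t_y$. Let $\gamma=2\Phi\big(\Phi^{-1}(\hat S(\bm x))-\epsilon\big)-1$, and suppose that $\mathrm{Cos}(\hat{\bm z}',\bm z)=\gamma$. Then $$\left|\hat{\bm z}'^\top\bm t_y-\gamma a_y\right|\le\sqrt{(1-\gamma^2)(1-a_y^2)} .$$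
   Context: $\mathcal N(0,I)$ is the standard Gaussian on $\mathbb{R}^d$. $\mathrm{Cos}(\bm u,\bm v)=\frac{\bm u^\top\bm v}{\|\bm u\|_2\|\bm v\|_2}$. The Gaussian robustness score is $\hat S(\bm x)=\tfrac12\big(1+\mathbb{E}_{\bm\varepsilon\sim\mathcal N(0,I)}[\mathrm{Cos}(f_e(\bm x+\bm\varepsilon),f_e(\bm x))]\big)\in[0,1]$. $\Phi$ is the standard Gaussian cumulative distribution function and $\Phi^{-1}$ its inverse, with $\Phi^{-1}(0)=-\infty$, $\Phi^{-1}(1)=+\infty$, $\Phi(-\infty)=0$, $\Phi(+\infty)=1$. It is assumed that $\hat f_e(\bm x')\neq 0$, so that $\hat{\bm z}'$ is defined. *)

(* Defs.v *)
From HB Require Import structures.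
From mathcomp Require Import all_boot all_order all_algebra.
From mathcomp Require Import all_classical all_reals all_analysis.
From mathcomp Require Import measurable_realfun lra.

Set Implicit Arguments.
Unset Strict Implicit.
Unset Printing Implicit Defensive.

Import Order.TTheory GRing.Theory Num.Theory.
Import numFieldNormedType.Exports.

Local Open Scope classical_set_scope.
Local Open Scope ring_scope.

(* Row vectors carry the product sigma-algebra, generated by the coordinate
   projections; for R : realType it is the Borel sigma-algebra of R^n. *)
Section measurable_row.
Context {d : measure_display} {T : measurableType d}.
Variable n : nat.

Let coord : 'I_n -> 'rV[T]_n -> T := fun i v => v ord0 i.

Let row_set0 : g_sigma_preimage coord set0.
Proof. exact: sigma_algebra0. Qed.

Let row_setC A : g_sigma_preimage coord A -> g_sigma_preimage coord (~` A).
Proof. exact: sigma_algebraC. Qed.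

Let row_bigcup (F : (set 'rV[T]_n)^nat) :
  (forall i, g_sigma_preimage coord (F i)) ->
  g_sigma_preimage coord (\bigcup_i (F i)).
Proof. exact: sigma_algebra_bigcup. Qed.

HB.instance Definition _ := @isMeasurable.Build (measure_tuple_display d)
  'rV[T]_n (g_sigma_preimage coord) row_set0 row_setC row_bigcup.

End measurable_row.

Lemma measurable_coord d (T : measurableType d) n (i : 'I_n) :
  measurable_fun [set: 'rV[T]_n] (fun v : 'rV[T]_n => v ord0 i).
Proof.
move=> _ Y mY; rewrite setTI; apply: sub_sigma_algebra => /=.
rewrite -bigcup_seq/=; exists i => /=; first by rewrite mem_index_enum.
by exists Y => //; rewrite setTI.
Qed.

Lemma measurable_rowP d1 d2 (T1 : measurableType d1) (T2 : measurableType d2) n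
    (f : T1 -> 'rV[T2]_n) :
  (forall i, measurable_fun [set: T1] (fun t => f t ord0 i)) ->
  measurable_fun [set: T1] f.
Proof.
move=> mf _ A mA; rewrite setTI.
suff: g_sigma_preimage (fun i (v : 'rV[T2]_n) => v ord0 i) `<=`
  [set B | measurable (f @^-1` B)] by apply.
apply: smallest_sub.
  split => [|B mB|F mF] /=; first by rewrite preimage_set0.
    by rewrite setTD; exact: (measurableC mB).
  by rewrite preimage_bigcup; apply: bigcup_measurable => k _; exact: mF.
move=> B; rewrite -bigcup_seq => -[i _] [C mC <-] /=.
by rewrite setTI; have := mf i measurableT C mC; rewrite setTI.
Qed.

Section std_gaussian.
Context {R : realType}.

Definition row_cons n (p : measurableTypeR R * 'rV[R]_n) : 'rV[R]_n.+1 :=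
  row_mx (p.1 : R)%:M p.2.

Lemma measurable_row_cons n : measurable_fun setT (@row_cons n).
Proof.
apply: measurable_rowP => i; case: (split_ordP (i : 'I_(1 + n))) => j ->.
  rewrite (_ : (fun _ => _) = fst) ?measurable_fst//.
  apply/funext => p; rewrite /row_cons (row_mxEl p.1%:M p.2).
  by rewrite (ord1 j) mxE eqxx mulr1n.
rewrite (_ : (fun _ => _) = (fun v : 'rV[R]_n => v ord0 j) \o snd).
  by apply: measurableT_comp => //; exact: measurable_coord.
by apply/funext => p; rewrite /row_cons (row_mxEr p.1%:M p.2).
Qed.

HB.instance Definition _ n :=
  isMeasurableFun.Build _ _ _ _ (@row_cons n) (@measurable_row_cons n).

(* N(0, I_n): the law of a vector of n independent N(0, 1) coordinates. *)
Fixpoint std_gaussian n : probability 'rV[R]_n R :=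
  if n is k.+1 then
    distribution (normal_prob 0 1 \x std_gaussian k)%E (@row_cons k)
  else dirac (0 : 'rV[R]_0).

End std_gaussian.

Lemma row_consE (R : realType) n (p : R * 'rV[R]_n) :
  row_cons p ord0 ord0 = p.1 /\
  (forall j, row_cons p ord0 (lift ord0 j) = p.2 ord0 j).
Proof.
split=> [|j]; rewrite /row_cons.
  have -> : ord0 = lshift n (ord0 : 'I_1) by exact: val_inj.
  by rewrite (row_mxEl p.1%:M p.2) mxE eqxx mulr1n.
have -> : lift ord0 j = rshift 1 j by exact: val_inj.
by rewrite (row_mxEr p.1%:M p.2).
Qed.

Lemma measurable_box (R : realType) n (A : 'I_n -> set R) :
  (forall i, measurable (A i)) ->
  measurable [set v : 'rV[R]_n | forall i, A i (v ord0 i)].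
Proof.
move=> mA; rewrite (_ : [set _ | _] = \bigcap_(i in [set: 'I_n])
    ((fun v : 'rV[R]_n => v ord0 i) @^-1` A i)).
  apply: fin_bigcap_measurable => // i _.
  by rewrite -[X in measurable X]setTI; exact: measurable_coord.
by apply/seteqP; split=> [v /= vA i _|v /= vA i]; [exact: vA|exact: (vA i)].
Qed.

Lemma std_gaussian_box (R : realType) n (A : 'I_n -> set R) :
  (forall i, measurable (A i)) ->
  std_gaussian n [set v | forall i, A i (v ord0 i)] =
  (\prod_(i < n) normal_prob 0 1 (A i))%E.
Proof.
elim: n A => [|n IHn] A mA.
  by rewrite big_ord0 /= diracE mem_set// => -[].
rewrite big_ord_recl -IHn//= /distribution /pushforward.
rewrite -product_measure1E; [|exact: mA|exact: (measurable_box (fun i => mA (lift ord0 i)))].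
congr (_ _); apply/seteqP; split=> -[x v] /=; have /= [h0 hS] := row_consE (x, v).
  by move=> vA; split=> [|i] /=; [rewrite -h0|rewrite -hS]; exact: vA.
by move=> [xA vA] i; case: (unliftP ord0 i) => [j|] ->; rewrite ?h0 ?hS.
Qed.

Section cosine.
Context {R : realType}.

Definition dot n (u v : 'rV[R]_n) : R := (u *m v^T) ord0 ord0.

(* The norm `|u| of the library is the sup norm on row vectors. *)
Definition norm2 n (u : 'rV[R]_n) : R := Num.sqrt (dot u u).

Definition Cos n (u v : 'rV[R]_n) : R := dot u v / (norm2 u * norm2 v).

End cosine.

Section Phi.
Context {R : realType}.

Definition Phi (x : \bar R) : R :=
  match x with
  | r%:E => fine (normal_prob 0 1 `]-oo, r])
  | +oo%E => 1
  | -oo%E => 0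
  end.

Definition Phi_inv : R -> \bar R := pinv [set: \bar R] Phi.

End Phi.

Section Phi_theory.
Context {R : realType}.
Local Notation N01 := (normal_prob (0 : R) 1).
Implicit Types a b r : R.

Lemma EFin_Phi r : (Phi r%:E)%:E = N01 `]-oo, r].
Proof. by rewrite /Phi fineK// fin_num_measure//; exact: measurable_itv. Qed.

Lemma PhiB a b : a <= b -> N01 `]a, b] = (Phi b%:E - Phi a%:E)%:E.
Proof.
move=> ab; rewrite EFinB !EFin_Phi.
have -> : `]-oo, b]%classic = `]-oo, a] `|` `]a, b] :> set R.
  by rewrite -itv_bndbnd_setU// ?bnd_simp.
rewrite measureU//=.
- by rewrite [X in (X - _)%E]addeC addeK// fin_num_measure//; exact: measurable_itv.
- by apply/seteqP; split => x//=; rewrite !in_itv/= => -[]; case: (leP x a).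
Qed.

Lemma normal_itv_le a b : a <= b -> 
  (N01 `]a, b] <= (normal_peak 1 * (b - a))%:E)%E.
Proof.
move=> ab; rewrite /normal_prob.
apply: (@le_trans _ _ (\int[lebesgue_measure]_(x in `]a, b]) (normal_peak (1:R))%:E)%E).
  apply: ge0_le_integral => //=.
  - by move=> x _; rewrite lee_fin normal_pdf_ge0.
  - by apply/measurable_EFinP; apply: measurable_funTS; exact: measurable_normal_pdf.
  - by move=> x _; rewrite lee_fin normal_pdf_ub// oner_neq0.
rewrite integral_cst; last exact: measurable_itv.
rewrite /= lebesgue_measure_itv/=; case: ifPn => // _.
by rewrite mule0 lee_fin mulr_ge0 ?normal_peak_ge0 ?subr_ge0.
Qed.

Lemma normal_itv_gt0 a b : a < b -> (0 < N01 `]a, b])%E.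
Proof.
move=> ab; rewrite /normal_prob.
pose M := `|a| + `|b|; pose c := normal_peak (1:R) * expR (- M ^+ 2 / (1 ^+ 2 *+ 2)).
have c0 : 0 < c by rewrite mulr_gt0 ?expR_gt0// normal_peak_gt0// oner_neq0.
apply: (@lt_le_trans _ _ (\int[lebesgue_measure]_(x in `]a, b]) c%:E)%E).
  rewrite integral_cst; last exact: measurable_itv.
  by rewrite /= lebesgue_measure_itv/= lte_fin ab -EFinB -EFinM lte_fin mulr_gt0// subr_gt0.
apply: ge0_le_integral => //=.
- by move=> x _; rewrite lee_fin ltW.
- by apply/measurable_EFinP; apply: measurable_funTS; exact: measurable_normal_pdf.
- move=> x; rewrite in_itv/= => /andP[ax xb].
  rewrite lee_fin normal_pdfE ?oner_neq0// ler_wpM2l ?normal_peak_ge0//.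
  rewrite ler_expR subr0 ler_pM2r ?invr_gt0 ?mulrn_wgt0 ?expr1n ?ltr01//.
  rewrite lerN2 -[x ^+ 2]real_normK ?num_real// lerXn2r ?nnegrE ?addr_ge0//.
  rewrite /M ler_norml; move: (ler_norm b) (ler_norm (- a)); rewrite normrN.
  move: (normr_ge0 a) (normr_ge0 b) ax xb; move: `|a| `|b| => A B *; lra.
Qed.

Lemma Phi_ltr a b : a < b -> Phi a%:E < Phi b%:E.
Proof.
by move=> ab; have := normal_itv_gt0 ab; rewrite PhiB ?ltW// lte_fin subr_gt0.
Qed.

Let idN : measurableTypeR R -> R := idfun.
#[local] HB.instance Definition _ :=
  @isMeasurableFun.Build _ _ _ _ idN (@measurable_id _ _ setT).

Lemma cdf_Phi : cdf (idN : {RV N01 >-> R}) = EFin \o Phi \o EFin.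
Proof. by apply/funext => r /=; rewrite EFin_Phi. Qed.

Lemma Phi_cvgy : Phi r%:E @[r --> +oo] --> (1 : R).
Proof.
have := cvg_cdfy1 (idN : {RV N01 >-> R}); rewrite cdf_Phi => /fine_cvgP[_].
exact.
Qed.

Lemma Phi_cvgNy : Phi r%:E @[r --> -oo] --> (0 : R).
Proof.
have := cvg_cdfNy0 (idN : {RV N01 >-> R}); rewrite cdf_Phi => /fine_cvgP[_].
exact.
Qed.

Lemma Phi_lip a b : `|Phi a%:E - Phi b%:E| <= normal_peak 1 * `|a - b|.
Proof.
wlog ab : a b / a <= b.
  by move=> h; have [/h//|/ltW/h] := leP a b; rewrite distrC [`|a - b|]distrC.
have := normal_itv_le ab; rewrite PhiB// lee_fin => h.
rewrite distrC [`|a - b|]distrC [`|b - a|]ger0_norm ?subr_ge0//.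
rewrite ger0_norm// subr_ge0; move: ab; rewrite le_eqVlt => /predU1P[->//|].
by move/Phi_ltr/ltW.
Qed.

Lemma Phi_continuous : continuous (fun r => Phi r%:E).
Proof.
have p0 : 0 < normal_peak (1 : R) by rewrite normal_peak_gt0// oner_neq0.
move=> a; apply/cvgrPdist_le => e e0; near=> b.
apply: le_trans (Phi_lip _ _) _; rewrite mulrC -ler_pdivlMr//.
by near: b; apply: cvgr_dist_le; [exact: cvg_id|rewrite divr_gt0].
Unshelve. all: by end_near. Qed.

Lemma Phi_in01 r : 0 < Phi r%:E < 1.
Proof.
have h (s : R) : 0 <= Phi s%:E <= 1.
  rewrite -!lee_fin EFin_Phi measure_ge0 /=.
  by apply: probability_le1; exact: measurable_itv.
have h1 : r - 1 < r by rewrite ltrBlDr ltrDl.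
have h2 : r < r + 1 by rewrite ltrDl.
have /andP[+ _] := h (r - 1); move/le_lt_trans/(_ (Phi_ltr h1)) => ->.
have /andP[_ +] := h (r + 1); exact/lt_le_trans/(Phi_ltr h2).
Qed.

Lemma Phi_lt (x y : \bar R) : (x < y)%E -> Phi x < Phi y.
Proof.
case: x y => [a||] [b||]//=; rewrite ?lte_fin; first exact: Phi_ltr.
- by move=> _; have /andP[] := Phi_in01 a.
- by move=> _; have /andP[] := Phi_in01 b.
Qed.

Lemma Phi_bij : set_bij [set: \bar R] `[0, 1] Phi.
Proof.
split.
- move=> [r||] _ /=; rewrite in_itv/= ?lexx ?ler01//.
  by have /andP[/ltW -> /ltW ->] := Phi_in01 r.
- move=> x y _ _ Pxy; apply/eqP; rewrite eq_le !leNgt.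
  by apply/andP; split; apply/negP => /Phi_lt; rewrite Pxy ltxx.
- move=> p /=; rewrite in_itv/= => /andP[]; rewrite le_eqVlt => /predU1P[<- _|p0].
    by exists -oo%E.
  rewrite le_eqVlt => /predU1P[->|p1]; first by exists +oo%E.
  have [a Pa] : exists a, Phi a%:E <= p.
    have /cvgr_le/(_ p p0) [M [_ h]] := Phi_cvgNy.
    by exists (M - 1); apply: h; rewrite ltrBlDr ltrDl.
  have [b Pb] : exists b, p <= Phi b%:E.
    have /cvgr_ge/(_ p p1) [M [_ h]] := Phi_cvgy.
    by exists (M + 1); apply: h; rewrite ltrDl.
  have ab : a <= b.
    by rewrite leNgt; apply/negP => /Phi_ltr; rewrite ltNge (le_trans Pa).
  have [||c _ <-] := @IVT _ (fun r => Phi r%:E) a b p ab.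
  - exact/continuous_subspaceT/Phi_continuous.
  - by rewrite (min_idPl (le_trans Pa Pb)) (max_idPr (le_trans Pa Pb)) Pa Pb.
  - by exists c%:E.
Qed.

Lemma PhiK : cancel (@Phi R) Phi_inv.
Proof.
have [_ Phi_inj _] := Phi_bij.
by move=> x; rewrite /Phi_inv pinvKV ?inE// => y z _ _; apply: Phi_inj; rewrite inE.
Qed.

Lemma Phi_invK : {in `[0, 1], cancel (@Phi_inv R) Phi}.
Proof.
have [_ _ Phi_surj] := Phi_bij.
by move=> p p01; rewrite /Phi_inv pinvK// inE; exact: Phi_surj.
Qed.

End Phi_theory.

Section smoothing.
Context {R : realType} {d m : nat}.
Variable f : 'rV[R]_d -> 'rV[R]_m.

Definition smoothed (u : 'rV[R]_d) : 'rV[R]_m :=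
  \row_(j < m) fine 'E_(std_gaussian d)[fun eps => f (u + eps) ord0 j].

Definition robustness_score (x : 'rV[R]_d) : R :=
  2^-1 * (1 + fine 'E_(std_gaussian d)[fun eps => Cos (f (x + eps)) (f x)]).

End smoothing.

(* Main.v *)
(* If z, z', t are unit vectors with <z', z> = g and <z, t> = a, then z' - g z
   and t - a z are the components of z' and t orthogonal to z: their squared
   norms are 1 - g^2 and 1 - a^2, and their inner product is <z', t> - g a.
   Cauchy-Schwarz concludes. *)

Require Import Defs.
From HB Require Import structures.
From mathcomp Require Import all_boot all_order all_algebra.
From mathcomp Require Import all_classical all_reals all_analysis.
From mathcomp Require Import ring.

Set Implicit Arguments.
Unset Strict Implicit.
Unset Printing Implicit Defensive.

Import Order.TTheory GRing.Theory Num.Theory.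

Local Open Scope classical_set_scope.
Local Open Scope ring_scope.

Lemma dotE (R : realType) n (u v : 'rV[R]_n) :
  dot u v = \sum_i u ord0 i * v ord0 i.
Proof. by rewrite /dot mxE; apply: eq_bigr => i _; rewrite mxE. Qed.

Lemma dotC (R : realType) n (u v : 'rV[R]_n) : dot u v = dot v u.
Proof. by rewrite !dotE; apply: eq_bigr => i _; rewrite mulrC. Qed.

Lemma dotBl (R : realType) n (u v w : 'rV[R]_n) :
  dot (u - v) w = dot u w - dot v w.
Proof. by rewrite /dot mulmxBl !mxE. Qed.

Lemma dotZl (R : realType) n a (u v : 'rV[R]_n) : dot (a *: u) v = a * dot u v.
Proof. by rewrite /dot -scalemxAl mxE. Qed.

Lemma dotBr (R : realType) n (u v w : 'rV[R]_n) :
  dot u (v - w) = dot u v - dot u w.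
Proof. by rewrite !(dotC u) dotBl. Qed.

Lemma dotZr (R : realType) n a (u v : 'rV[R]_n) : dot u (a *: v) = a * dot u v.
Proof. by rewrite !(dotC u) dotZl. Qed.

Lemma dot_ge0 (R : realType) n (u : 'rV[R]_n) : 0 <= dot u u.
Proof. by rewrite dotE sumr_ge0// => i _; rewrite -expr2 sqr_ge0. Qed.

(** A sum of squares vanishes only if each square does. *)
Lemma dot_eq0 (R : realType) n (u : 'rV[R]_n) : (dot u u == 0) = (u == 0).
Proof.
apply/eqP/eqP => [|->]; last by rewrite dotE big1// => i _; rewrite mxE mul0r.
rewrite dotE => /psumr_eq0P u0; apply/rowP => i; rewrite mxE.
apply/eqP; rewrite -sqrf_eq0 expr2 u0// => j _.
by rewrite -expr2 sqr_ge0.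
Qed.

(** For [v != 0], expand the squared norm of [dot v v *: u - dot u v *: v], which is [dot v v] times
    the component of [u] orthogonal to [v]; this scaling avoids division. *)
Lemma dot_CauchySchwarz (R : realType) n (u v : 'rV[R]_n) :
  dot u v ^+ 2 <= dot u u * dot v v.
Proof.
have [->|v0] := eqVneq v 0.
  by rewrite dotC -(scale0r 0) !dotZl !mul0r mulr0 expr0n.
have vv_gt0 : 0 < dot v v by rewrite lt_def dot_eq0 v0 dot_ge0.
have := dot_ge0 (dot v v *: u - dot u v *: v).
rewrite !(dotBl, dotBr, dotZl, dotZr) (dotC v u) => h.
(* The expansion in [h] equals [dot v v] times the gap between the two sides. *)
rewrite -subr_ge0 -(pmulr_rge0 _ vv_gt0).
by apply: le_trans h _; rewrite le_eqVlt; apply/orP; left; apply/eqP; ring.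
Qed.

Lemma norm2_sqr (R : realType) n (u : 'rV[R]_n) : norm2 u ^+ 2 = dot u u.
Proof. by rewrite sqr_sqrtr// dot_ge0. Qed.

Lemma norm2_normalized (R : realType) n (u : 'rV[R]_n) :
  u != 0 -> norm2 ((norm2 u)^-1 *: u) = 1.
Proof.
move=> u0; have nu0 : norm2 u != 0 by rewrite -sqrf_eq0 norm2_sqr dot_eq0.
(* Only the outer norm is unfolded, so that [norm2 u] cancels against its inverse under the
   square. *)
by rewrite {1}/norm2 dotZl dotZr mulrA -norm2_sqr -expr2 -exprMn mulVf// expr1n sqrtr1.
Qed.

Lemma dot_unit_bound (R : realType) n (z w t : 'rV[R]_n) :
  norm2 z = 1 -> norm2 w = 1 -> norm2 t = 1 ->
  `|dot w t - dot w z * dot z t| <=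
    Num.sqrt ((1 - dot w z ^+ 2) * (1 - dot z t ^+ 2)).
Proof.
move=> z1 w1 t1.
have unit1 (u : 'rV[R]_n) : norm2 u = 1 -> dot u u = 1.
  by move=> u1; rewrite -norm2_sqr u1 expr1n.
have := dot_CauchySchwarz (w - dot w z *: z) (t - dot z t *: z).
rewrite !(dotBl, dotBr, dotZl, dotZr) (dotC z w) (dotC t z) !unit1// => h.
(* With the absolute value written as the root of a square, the claim is [h] up to a ring identity
   on each side. *)
rewrite -sqrtr_sqr ler_wsqrtr//; apply: le_trans (le_trans _ h) _;
  by rewrite le_eqVlt; apply/orP; left; apply/eqP; ring.
Qed.

Theorem theorem4p2 (R : realType) (d m : nat)
  (fe : 'rV[R]_d -> 'rV[R]_m)
  (mfe : measurable_fun [set: 'rV[R]_d] fe)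
  (fe_unit : forall u, norm2 (fe u) = 1)
  (x x' : 'rV[R]_d) (eps : R) (eps_ge0 : 0 <= eps)
  (xx'_eps : norm2 (x' - x) <= eps)
  (smoothed_neq0 : smoothed fe x' != 0)
  (ty : 'rV[R]_m) (ty_unit : norm2 ty = 1) :
  let z := fe x in
  let zhat' := (norm2 (smoothed fe x'))^-1 *: smoothed fe x' in
  let ay := dot z ty in
  let gamma := 2 * Phi (Phi_inv (robustness_score fe x) - eps%:E)%E - 1 in
  Cos zhat' z = gamma ->
  `|dot zhat' ty - gamma * ay| <= Num.sqrt ((1 - gamma ^+ 2) * (1 - ay ^+ 2)).
Proof.
move=> z zhat' ay gamma.
have zhat1 : norm2 zhat' = 1 by exact: norm2_normalized.
(* Both vectors are unit, so the cosine is their inner product, and the hypothesis turns [gamma]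
   into [dot zhat' z]. *)
rewrite /Cos zhat1 fe_unit mulr1 divr1 => <-.
exact: dot_unit_bound (fe_unit x) zhat1 ty_unit.
Qed.
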